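(* Let $H_1$ and $H_2$ be graphs. The class of $\{H_1, H_2\}$-free graphs is bounded-apex-chordal if and only if, up to switching the labels of $H_1$ and $H_2$, one of the following holds: 1. $H_1$ is an induced subgraph of $P_3$; 2. $H_1$ is an induced subgraph of $P_4$ and $H_2 \cong C_4$, in which case one can take $c=0$ (that is, every $\{H_1,H_2\}$-free graph is chordal); 3. $H_1 \cong 2K_2$ and $H_2 \cong C_4$; or 4. $H_1$ is a complete graph and $H_2$ is edgeless.
   Context: All graphs are finite and simple. $K_r$, $C_r$, $P_r$ denote the complete graph, cycle and path on $r$ vertices; $2K_2$ is the disjoint union of two copies of $K_2$. ''Induced subgraph of $X$'' means isomorphic to $X[S]$ for some $S\subseteq V(X)$. For a set $\mathcal{H}$ of graphs, a graph is $\mathcal{H}$-free if none of its induced subgraphs is isomorphic to a graph in $\mathcal{H}$. A graph is chordal if it has no induced cycle on four or more vertices. For $c\in\mathbb{N}$ (with $c=0$ allowed), a class of graphs is $c$-apex-chordal if every graph $G$ in the class has a set $S\subseteq V(G)$ with $|S|\le c$ such that $G-S$ is chordal; the class is bounded-apex-chordal if it is $c$-apex-chordal for some constant $c$. *)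

(* Defs.v *)
From mathcomp Require Import all_boot.

Set Implicit Arguments.
Unset Strict Implicit.
Unset Printing Implicit Defensive.

(* The null graph (no vertices) is allowed. *)
Record sgraph := SGraph {
  vertex :> finType;
  adj : rel vertex;
  adj_sym : symmetric adj;
  adj_irrefl : irreflexive adj
}.

Definition iso (G H : sgraph) : Prop :=
  exists f : G -> H, bijective f /\ forall x y : G, adj (f x) (f y) = adj x y.

Section Induced.
Variables (G : sgraph) (S : {set G}).

Definition induced_adj : rel {x : G | x \in S} :=
  fun x y => adj (val x) (val y).

Fact induced_adj_sym : symmetric induced_adj.
Proof. by move=> x y; apply: adj_sym. Qed.

Fact induced_adj_irrefl : irreflexive induced_adj.
Proof. by move=> x; apply: adj_irrefl. Qed.

Definition induced : sgraph := SGraph induced_adj_sym induced_adj_irrefl.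

End Induced.

Definition delete (G : sgraph) (S : {set G}) : sgraph := induced (~: S).

Definition induced_subgraph (H X : sgraph) : Prop :=
  exists S : {set X}, iso H (induced S).

Section Standard.
Variable r : nat.

Definition complete_adj : rel 'I_r := fun i j => i != j.

Fact complete_adj_sym : symmetric complete_adj.
Proof. by move=> i j; rewrite /complete_adj eq_sym. Qed.

Fact complete_adj_irrefl : irreflexive complete_adj.
Proof. by move=> i; rewrite /complete_adj eqxx. Qed.

Definition K_ : sgraph := SGraph complete_adj_sym complete_adj_irrefl.

Definition path_adj : rel 'I_r :=
  fun i j => (i.+1 == j :> nat) || (j.+1 == i :> nat).

Fact path_adj_sym : symmetric path_adj.
Proof. by move=> i j; rewrite /path_adj orbC. Qed.

Fact path_adj_irrefl : irreflexive path_adj.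
Proof. by move=> i; rewrite /path_adj orbb gtn_eqF. Qed.

Definition P_ : sgraph := SGraph path_adj_sym path_adj_irrefl.

(* [ordS] is the successor modulo [r]; the conjunct [i != j] only matters
   for [r = 1], where it prevents a loop. This is a cycle for [3 <= r]. *)
Definition cycle_adj : rel 'I_r :=
  fun i j => (i != j) && ((ordS i == j) || (ordS j == i)).

Fact cycle_adj_sym : symmetric cycle_adj.
Proof. by move=> i j; rewrite /cycle_adj eq_sym orbC. Qed.

Fact cycle_adj_irrefl : irreflexive cycle_adj.
Proof. by move=> i; rewrite /cycle_adj eqxx. Qed.

Definition C_ : sgraph := SGraph cycle_adj_sym cycle_adj_irrefl.

End Standard.

Section DisjointUnion.
Variables G H : sgraph.

Definition disjoint_union_adj : rel (G + H)%type := fun x y =>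
  match x, y with
  | inl a, inl b => adj a b
  | inr a, inr b => adj a b
  | _, _ => false
  end.

Fact disjoint_union_adj_sym : symmetric disjoint_union_adj.
Proof. by move=> [a|a] [b|b] //=; apply: adj_sym. Qed.

Fact disjoint_union_adj_irrefl : irreflexive disjoint_union_adj.
Proof. by move=> [a|a] /=; apply: adj_irrefl. Qed.

Definition disjoint_union : sgraph :=
  SGraph disjoint_union_adj_sym disjoint_union_adj_irrefl.

End DisjointUnion.

Definition two_K2 : sgraph := disjoint_union (K_ 2) (K_ 2).

Definition complete (G : sgraph) : Prop := forall x y : G, x != y -> adj x y.

Definition edgeless (G : sgraph) : Prop := forall x y : G, ~~ adj x y.

Definition graph_class := sgraph -> Prop.

Definition pair_set (H1 H2 : sgraph) : graph_class :=
  fun H => H = H1 \/ H = H2.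

Definition free (HH : graph_class) : graph_class :=
  fun G => forall H, HH H -> ~ induced_subgraph H G.

Definition chordal (G : sgraph) : Prop :=
  forall r, 4 <= r -> ~ induced_subgraph (C_ r) G.

Definition apex_chordal (c : nat) (CC : graph_class) : Prop :=
  forall G, CC G -> exists S : {set G}, #|S| <= c /\ chordal (delete S).

Definition bounded_apex_chordal (CC : graph_class) : Prop :=
  exists c, apex_chordal c CC.

(* Main.v *)
Require Import Defs.
From mathcomp Require Import all_boot zify.

(** Sufficiency. A cycle of length r contains every path on fewer than r vertices
    ([path_embeds_cycle]), so excluding an induced subgraph of P_m excludes all
    holes of length greater than m ([hole_length]). This settles the conditions on
    P_3 and P_4, and shows that a graph without induced C_4 and 2K_2 has holes of
    length five only, because 2K_2 is contained in P_5. If there is a pentagon,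
    every other vertex is adjacent to all or to none of it; the vertices of the
    first kind form a clique, the others an independent set, and so deleting the
    five vertices of the pentagon leaves no hole ([delete_pentagon_chordal]). If a
    complete and an edgeless graph are excluded, Ramsey's theorem bounds the number
    of vertices, and everything can be deleted.

    Necessity. Suppose that c deletions always suffice. A graph made of c + 1
    vertex-disjoint holes, with arbitrary adjacencies between different holes, is
    then not in the class, so it contains H_1 or H_2 ([bounded_embeds_layered]).
    Five families of such graphs are enough ([unbounded_hosts]). The first is the
    disjoint union of hexagons; let A be the excluded graph which it contains, and B
    the other one.
    - The cocktail party graph K_{2,...,2} is the join of copies of C_4. A
      triangle-free induced subgraph of it lies in C_4, hence is contained in P_3 or
      is C_4. As A is triangle-free without induced C_4, either A lies in P_3 or B
      is an induced subgraph of a cocktail party graph.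
    - If this B is triangle-free, it lies in P_3 or is C_4. Blow-ups of C_5 into
      cliques have no induced C_4, so in the second case they contain A. They have
      no three independent vertices, and the only such parts of a union of hexagons
      lie in P_4 or in 2K_2.
    - If B has a triangle, then the complete bipartite graphs contain A, which is
      therefore edgeless or contained in P_3. If B is also not complete, it contains
      a diamond, that is, K_4 minus an edge. Two cliques joined by a perfect
      matching contain no diamond, so they contain A; having no three independent
      vertices, they force an edgeless A into P_3. *)

Set Implicit Arguments.
Unset Strict Implicit.
Unset Printing Implicit Defensive.

(** * Induced subgraphs as embeddings *)

(** Boolean-valued, so that the case analyses on containment are constructive. *)
Definition embeds (H X : sgraph) : bool :=
  [exists f : {ffun H -> X},
     injectiveb f && [forall x, forall y, adj (f x) (f y) == adj x y]].

Lemma embedsP (H X : sgraph) :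
  reflect (exists f : H -> X, injective f /\ {mono f : x y / adj x y})
          (embeds H X).
Proof.
apply: (iffP existsP) => [[f /andP[/injectiveP f_inj /forallP f_adj]]|].
  by exists f; split=> // x y; have /forallP/(_ y)/eqP := f_adj x.
case=> f [f_inj f_adj]; exists [ffun x => f x]; apply/andP; split.
  by apply/injectiveP => x y; rewrite !ffunE => /f_inj.
by apply/forallP => x; apply/forallP => y; rewrite !ffunE f_adj.
Qed.

Lemma embeds_trans Y X Z : embeds X Y -> embeds Y Z -> embeds X Z.
Proof.
move=> /embedsP[f [f_inj f_adj]] /embedsP[g [g_inj g_adj]].
apply/embedsP; exists (g \o f); split; first exact: inj_comp.
by move=> x y /=; rewrite g_adj f_adj.
Qed.

Lemma iso_sym G H : iso G H -> iso H G.
Proof.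
case=> f [[g fK gK] f_adj]; exists g; split; first by exists f.
by move=> x y; rewrite -f_adj !gK.
Qed.

Lemma iso_embeds G H : iso G H -> embeds G H.
Proof.
by case=> f [f_bij f_adj]; apply/embedsP; exists f; split=> //; apply: bij_inj.
Qed.

Lemma induced_embeds (X : sgraph) (S : {set X}) : embeds (induced S) X.
Proof. by apply/embedsP; exists val; split=> //; apply: val_inj. Qed.

Lemma induced_subgraphP H X : induced_subgraph H X <-> embeds H X.
Proof.
split=> [[S /iso_embeds HS]|/embedsP[f [f_inj f_adj]]].
  exact: embeds_trans HS (induced_embeds S).
have fS x : f x \in [set f x | x : H] by apply: imset_f.
exists [set f x | x : H], (fun x => exist _ (f x) (fS x) : induced _).
split=> [|x y]; last exact: f_adj.
apply: inj_card_bij => [x y [/f_inj]|] //.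
by rewrite card_sig card_imset.
Qed.

Lemma embeds_iso_or_miss H X : embeds H X ->
  iso H X \/ exists (f : H -> X) (v : X),
    [/\ injective f, {mono f : x y / adj x y} & forall x, f x != v].
Proof.
case/embedsP=> f [f_inj f_adj].
case: (boolP [exists v, v \notin codom f]) => [/existsP[v v_f]|/existsPn f_onto].
  right; exists f, v; split=> // x; apply: contraNneq v_f => <-.
  exact: codom_f.
left; exists f; split=> //; apply: inj_card_bij => //.
rewrite -(card_codom f_inj); apply: subset_leq_card; apply/subsetP => v _.
by have:= f_onto v; rewrite negbK.
Qed.

Lemma adj_neq (G : sgraph) (x y : G) : adj x y -> x != y.
Proof. by apply: contraTneq => ->; rewrite adj_irrefl. Qed.

Lemma free_pairP A B G :
  free (pair_set A B) G <-> ~~ embeds A G /\ ~~ embeds B G.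
Proof.
split=> [G_free|[nA nB] H HH /induced_subgraphP H_G].
  split; apply/negP => /induced_subgraphP; apply: G_free.
    by left.
  by right.
by case: HH H_G => ->; apply/negP.
Qed.

Lemma free_pairC A B G : free (pair_set A B) G <-> free (pair_set B A) G.
Proof. by split=> /free_pairP[nA nB]; apply/free_pairP. Qed.

(** * Paths and cycles *)

Lemma cycle_adjE r (i j : 'I_r) : cycle_adj i j =
  (i != j :> nat) && [|| i.+1 == j, j.+1 == i,
    (i.+1 == r) && (j == 0 :> nat) | (j.+1 == r) && (i == 0 :> nat)].
Proof.
have ordSE (k l : 'I_r) :
    (ordS k == l) = (k.+1 == l) || ((k.+1 == r) && (l == 0 :> nat)).
  rewrite -val_eqE /=; case: (eqVneq k.+1 r) => [->|kr].
    by rewrite modnn eq_sym; have := ltn_ord l; lia.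
  by rewrite modn_small ?orbF // ltn_neqAle kr ltn_ord.
by rewrite /cycle_adj -val_eqE !ordSE /=; congr (_ && _); lia.
Qed.

Lemma path_embeds_cycle m r : m < r -> embeds (P_ m) (C_ r).
Proof.
move=> mr; apply/embedsP; exists (widen_ord (ltnW mr)); split.
  by move=> i j /(congr1 val) /= /val_inj.
move=> i j; rewrite /= cycle_adjE /path_adj /=.
have := ltn_ord i; have := ltn_ord j; lia.
Qed.

Lemma hole_length A G m r :
  ~~ embeds A G -> embeds A (P_ m) -> embeds (C_ r) G -> r <= m.
Proof.
move=> nA A_P C_G; rewrite leqNgt; apply: contra nA => mr.
exact: embeds_trans A_P (embeds_trans (path_embeds_cycle mr) C_G).
Qed.

(** The cycle is cut open at the missed vertex v, and positions are counted from
    the successor of v. *)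
Lemma miss_cycle_embeds_path (H : sgraph) r (f : H -> C_ r.+1) (v : C_ r.+1) :
  injective f -> {mono f : x y / adj x y} -> (forall x, f x != v) ->
  embeds H (P_ r).
Proof.
move=> f_inj f_adj f_miss.
pose pos (a : 'I_r.+1) : nat := if v < a then a - v.+1 else a + r - v.
have pos_lt x : pos (f x) < r.
  have := f_miss x; rewrite /pos -val_eqE /=.
  by have := ltn_ord v; have := ltn_ord (f x); case: (ltnP v (f x)); lia.
apply/embedsP; exists (fun x => Ordinal (pos_lt x)); split=> [x y|x y].
  move=> /(congr1 val) /=; rewrite /pos => e; apply: f_inj; apply: val_inj.
  move: e (ltn_ord v) (ltn_ord (f x)) (ltn_ord (f y)) (f_miss x) (f_miss y).
  by rewrite -!val_eqE /=; case: (ltnP v (f x)); case: (ltnP v (f y)); lia.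
rewrite -f_adj /= cycle_adjE /path_adj /= /pos.
move: (ltn_ord v) (ltn_ord (f x)) (ltn_ord (f y)) (f_miss x) (f_miss y).
by rewrite -!val_eqE /=; case: (ltnP v (f x)); case: (ltnP v (f y)); lia.
Qed.

Lemma embeds_C4 H : embeds H (C_ 4) -> embeds H (P_ 3) \/ iso H (C_ 4).
Proof.
case/embeds_iso_or_miss=> [|[f [v [f_inj f_adj f_miss]]]]; first by right.
by left; apply: miss_cycle_embeds_path f_miss.
Qed.

(** C_4 is the complete bipartite graph K_{2,2}, with the parities as sides. *)
Lemma C4_adjE (i j : 'I_4) : cycle_adj i j = (odd i != odd j).
Proof. by move: i j => [[|[|[|[|i]]]] ?] [[|[|[|[|j]]]] ?]. Qed.

(** * Graphs contained in C_4, P_4 or 2K_2 *)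

Definition triangle_free (X : sgraph) : bool :=
  ~~ [exists x : X, exists y : X, exists z : X,
        [&& adj x y, adj x z & adj y z]].

Lemma triangle_freeP (X : sgraph) :
  reflect (forall x y z : X, adj x y -> adj x z -> ~~ adj y z)
          (triangle_free X).
Proof.
apply: (iffP idP) => [Xfree x y z xy xz|Xfree].
  apply: contraNN Xfree => yz.
  by apply/existsP; exists x; apply/existsP; exists y; apply/existsP; exists z;
     rewrite xy xz.
apply/existsP => -[x /existsP[y /existsP[z /and3P[xy xz]]]].
exact/negP/(Xfree x).
Qed.

Definition indep3_free (X : sgraph) : Prop := forall x y z : X,
  x != y -> x != z -> y != z -> [|| adj x y, adj x z | adj y z].

Lemma embeds_indep3_free X Y : embeds X Y -> indep3_free Y -> indep3_free X.
Proof.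
case/embedsP=> f [f_inj f_adj] Y_free x y z xy xz yz.
by rewrite -!f_adj; apply: Y_free; rewrite inj_eq.
Qed.

(** Two bits per vertex: s gives the side of K_{2,2}, b the place in it. *)
Lemma bits_embed_C4 (X : sgraph) (s b : X -> bool) :
  (forall x y, adj x y = (s x != s y)) ->
  injective (fun x => (s x, b x)) -> embeds X (C_ 4).
Proof.
move=> X_adj sb_inj.
have pos_lt x : s x + (b x).*2 < 4 by case: (s x) (b x) => [] [].
apply/embedsP; exists (fun x => Ordinal (pos_lt x)); split=> x y.
  move=> /(congr1 val) /= e; apply: sb_inj; move: e.
  by case: (s x) (b x) (s y) (b y) => [] [] [] [].
by rewrite X_adj /= C4_adjE /= !oddD !odd_double !addbF !oddb.
Qed.

Lemma bits_embed_two_K2 (X : sgraph) (s b : X -> bool) :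
  (forall x y, adj x y = (s x == s y) && (b x != b y)) ->
  injective (fun x => (s x, b x)) -> embeds X two_K2.
Proof.
move=> X_adj sb_inj.
pose bit (c : bool) : 'I_2 := if c then ord_max else ord0.
pose side (c : bool) (i : 'I_2) : 'I_2 + 'I_2 := if c then inl i else inr i.
apply/embedsP; exists (fun x => side (s x) (bit (b x))); split=> x y.
  move=> e; apply: sb_inj; move: e.
  by case: (s x) (b x) (s y) (b y) => [] [] [] [].
by rewrite X_adj; case: (s x) (b x) (s y) (b y) => [] [] [] [].
Qed.

Lemma embeds_two_K2 X :
  embeds X two_K2 -> embeds X (P_ 4) \/ iso X two_K2.
Proof.
case/embeds_iso_or_miss=> [|[f [v [f_inj f_adj f_miss]]]]; first by right.
pose side (w : two_K2) := if w is inl _ then true else false.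
pose bit (w : two_K2) : nat := match w with inl i => i | inr i => i end.
(* The edge of v has only one endpoint left, sent to the far end of the path;
   the other edge goes to the first two vertices. *)
pose pos w := if side w == side v then 3 else bit w.
have pos_lt w : pos w < 4.
  by rewrite /pos; case: ifP => // _; case: w => i; apply: ltn_trans (ltn_ord i) _.
left; apply/embedsP; exists (fun x => Ordinal (pos_lt (f x))); split=> x y.
  move=> /(congr1 val) /= e; apply: f_inj; move: e (f_miss x) (f_miss y).
  rewrite /pos; clear; case: (f x) (f y) v => [[[|[|i]] ?]|[[|[|i]] ?]] //
    [[[|[|j]] ?]|[[|[|j]] ?]] // [[[|[|k]] ?]|[[|[|k]] ?]] //= _ _ _;
    by congr (_ _); apply: val_inj.
rewrite -f_adj; move: (f_miss x) (f_miss y); rewrite /= /path_adj /= /pos.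
by clear; case: (f x) (f y) v => [[[|[|i]] ?]|[[|[|i]] ?]] //
    [[[|[|j]] ?]|[[|[|j]] ?]] // [[[|[|k]] ?]|[[|[|k]] ?]].
Qed.

(** The vertices of P_5 at positions 0, 2 and 4 are independent, so one of them is
    missed. Without an end P_5 becomes P_4, without its centre 2K_2. *)
Lemma indep3_free_path5 X : embeds X (P_ 5) -> indep3_free X ->
  embeds X (P_ 4) \/ embeds X two_K2.
Proof.
case/embedsP=> f [f_inj f_adj] X_free.
case: (boolP [exists x, f x == 0 :> nat]) => [/existsP[x0 /eqP fx0]|]; last first.
  move=> /existsPn f_miss; left.
  have pos_lt x : (f x).-1 < 4.
    by have := f_miss x; have := ltn_ord (f x); lia.
  apply/embedsP; exists (fun x => Ordinal (pos_lt x)); split=> x y.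
    move=> /(congr1 val) /= e; apply: f_inj; apply: val_inj.
    by have := f_miss x; have := f_miss y; move: e => /=; lia.
  rewrite -f_adj /= /path_adj /=.
  by have := f_miss x; have := f_miss y; lia.
case: (boolP [exists x, f x == 4 :> nat]) => [/existsP[x4 /eqP fx4]|]; last first.
  move=> /existsPn f_miss; left.
  have pos_lt x : f x < 4.
    by have := f_miss x; have := ltn_ord (f x); lia.
  apply/embedsP; exists (fun x => Ordinal (pos_lt x)); split=> x y.
    by move=> /(congr1 val) /= e; apply: f_inj; apply: val_inj.
  by rewrite -f_adj.
have f_miss x : f x != 2 :> nat.
  apply/negP => /eqP fx2.
  have neq u v : f u <> f v :> nat -> u != v.
    by move=> uv; apply: contra_notN uv => /eqP->.
  have := X_free x0 x x4; rewrite !neq ?fx0 ?fx2 ?fx4 // => /(_ isT isT isT).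
  by rewrite -!f_adj /= /path_adj fx0 fx2 fx4.
right; apply: (@bits_embed_two_K2 _ (fun x => f x < 2) (fun x => odd (f x))).
  move=> x y; rewrite -f_adj /= /path_adj; move: (f_miss x) (f_miss y).
  by case: (f x) (f y) => [[|[|[|[|[|i]]]]] ?] [[|[|[|[|[|j]]]]] ?].
move=> x y e; apply: f_inj; apply: val_inj; move: e (f_miss x) (f_miss y).
by case: (f x) (f y) => [[|[|[|[|[|i]]]]] ?] [[|[|[|[|[|j]]]]] ?].
Qed.

(** * Graphs made of disjoint holes *)

Section Layered.
Variables (r : nat) (E : rel 'I_r) (E_sym : symmetric E) (n : nat).

(** The layers i are disjoint holes. That E is arbitrary lets one counting argument
    serve for all the families below. *)
Definition layered_adj : rel ('I_n * 'I_r) := fun x y =>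
  if x.1 == y.1 then cycle_adj x.2 y.2 else E x.2 y.2.

Fact layered_adj_sym : symmetric layered_adj.
Proof.
by move=> x y; rewrite /layered_adj eq_sym cycle_adj_sym E_sym.
Qed.

Fact layered_adj_irrefl : irreflexive layered_adj.
Proof. by move=> x; rewrite /layered_adj eqxx cycle_adj_irrefl. Qed.

Definition layered : sgraph := SGraph layered_adj_sym layered_adj_irrefl.

(** The layers are disjoint, so fewer than n deletions leave one of them whole. *)
Lemma layered_not_apex (S : {set layered}) :
  3 < r -> #|S| < n -> ~ chordal (delete S).
Proof.
move=> r_gt3 S_lt /(_ r r_gt3); apply.
have [i i_free] : exists i : 'I_n, forall a, (i, a) \notin S.
  case: (boolP [exists i : 'I_n, i \notin [set x.1 | x in S]]).
    case/existsP=> i /imsetP iS; exists i => a; apply/negP => aS.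
    by apply: iS; exists (i, a).
  move=> /existsPn onto; have : #|'I_n| <= #|[set x.1 | x in S]|.
    apply: subset_leq_card; apply/subsetP => i _.
    by have := onto i; rewrite negbK.
  by rewrite card_ord leqNgt (leq_ltn_trans (leq_imset_card _ _) S_lt).
have iS a : (i, a) \in ~: S by rewrite inE i_free.
apply/induced_subgraphP/embedsP.
exists (fun a => exist _ (i, a) (iS a) : delete S); split=> [a b [] //|a b].
by rewrite /= /induced_adj /= /layered_adj eqxx.
Qed.

End Layered.

Lemma bounded_embeds_layered A B r (E : rel 'I_r) (E_sym : symmetric E) :
  bounded_apex_chordal (free (pair_set A B)) -> 3 < r ->
  exists n, embeds A (layered E_sym n) \/ embeds B (layered E_sym n).
Proof.
case=> c c_apex r_gt3; exists c.+1.
case: (boolP (embeds A _)) => [|nA]; first by left.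
case: (boolP (embeds B _)) => [|nB]; first by right.
have [S [S_le S_chordal]] := c_apex _ ((free_pairP _ _ _).2 (conj nA nB)).
by case: (@layered_not_apex _ _ E_sym c.+1 S).
Qed.

(** * Five families *)

Section Hosts.
Variable n : nat.

Definition no_adj r : rel 'I_r := fun _ _ => false.
Definition full_adj r : rel 'I_r := fun _ _ => true.
Definition parity_adj r : rel 'I_r := fun a b => odd a != odd b.
Definition closed_adj r : rel 'I_r := fun a b => (a == b) || cycle_adj a b.
Definition half_adj : rel 'I_4 := fun a b => (a < 2) == (b < 2).

Fact no_adj_sym r : symmetric (@no_adj r). Proof. by []. Qed.
Fact full_adj_sym r : symmetric (@full_adj r). Proof. by []. Qed.
Fact parity_adj_sym r : symmetric (@parity_adj r).
Proof. by move=> a b; rewrite /parity_adj eq_sym. Qed.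
Fact closed_adj_sym r : symmetric (@closed_adj r).
Proof. by move=> a b; rewrite /closed_adj eq_sym cycle_adj_sym. Qed.
Fact half_adj_sym : symmetric half_adj.
Proof. by move=> a b; rewrite /half_adj eq_sym. Qed.

(** Shorter layers would not do: copies of C_4 contain C_4, and copies of C_5 contain
    the pentagon, which has no three independent vertices but lies neither in P_4
    nor in 2K_2. *)
Definition disjoint_C6s := layered (@no_adj_sym 6) n.
Definition cocktail_party := layered (@full_adj_sym 4) n.
(** C_4 is itself the parity graph on its positions, so [parity_adj] extends the
    two sides across all layers. *)
Definition complete_bipartite := layered (@parity_adj_sym 4) n.
(** The five cliques of the blow-up are the sets of vertices at the same position. *)
Definition blown_up_C5 := layered (@closed_adj_sym 5) n.
(** The halves {0,1} and {2,3} of the layers form the two cliques; the edges 12 and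
    30 of each layer form the matching. *)
Definition matched_cliques := layered half_adj_sym n.

Lemma C6_adj_parity (a b : 'I_6) : cycle_adj a b -> odd a != odd b.
Proof. rewrite cycle_adjE; lia. Qed.

Lemma C6s_adjP (x y : disjoint_C6s) :
  adj x y -> x.1 = y.1 /\ cycle_adj x.2 y.2.
Proof. by rewrite /= /layered_adj; case: eqP. Qed.

Lemma C6s_common_nbr (a b c d : disjoint_C6s) :
  adj a b -> adj c b -> adj c d -> adj a d -> a = c \/ b = d.
Proof.
case: a b c d => [i a] [j b] [k c] [l d].
move=> /C6s_adjP[/= <- ab] /C6s_adjP[/= -> cb] /C6s_adjP[/= <- cd].
move=> /C6s_adjP[_ /= ad].
suff [->|->] : a = c \/ b = d by [left|right].
suff : (a == c) || (b == d) by case/orP=> /eqP; [left|right].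
rewrite -!val_eqE /=; move: ab cb cd ad; rewrite !cycle_adjE /=.
by move: (ltn_ord a) (ltn_ord b) (ltn_ord c) (ltn_ord d); lia.
Qed.

Lemma C6s_no_C4 : ~~ embeds (C_ 4) disjoint_C6s.
Proof.
apply/negP => /embedsP[f [f_inj f_adj]].
pose v k : C_ 4 := inord k.
have := @C6s_common_nbr (f (v 0)) (f (v 1)) (f (v 2)) (f (v 3)).
rewrite !f_adj /= !C4_adjE !inordK // => /(_ isT isT isT isT).
by case=> /f_inj/(congr1 val) /=; rewrite !inordK.
Qed.

(** Non-adjacency is an equivalence relation, whose classes are the two pairs of
    opposite vertices of each layer. *)
Lemma cocktail_nonadj (x y : cocktail_party) :
  ~~ adj x y = (x.1 == y.1) && (odd x.2 == odd y.2).
Proof.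
by rewrite /= /layered_adj C4_adjE; case: eqP; rewrite ?negbK.
Qed.

Lemma bipartite_adj (x y : complete_bipartite) :
  adj x y = (odd x.2 != odd y.2).
Proof. by rewrite /= /layered_adj C4_adjE; case: ifP. Qed.

Lemma blown_up_C5_near (x y : blown_up_C5) : adj x y -> closed_adj x.2 y.2.
Proof.
by rewrite /= /layered_adj /closed_adj; case: ifP => // _ ->; rewrite orbT.
Qed.

Lemma blown_up_C5_far (x y : blown_up_C5) :
  x != y -> ~~ adj x y -> ~~ closed_adj x.2 y.2.
Proof.
case: x y => [i a] [j b]; rewrite xpair_eqE /= /layered_adj /=.
by case: (i == j) => //= ab nab; rewrite /closed_adj negb_or ab.
Qed.

Lemma blown_up_C5_indep3_free : indep3_free blown_up_C5.
Proof.
move=> x y z /blown_up_C5_far xy /blown_up_C5_far xz /blown_up_C5_far yz.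
apply/negPn/negP; rewrite !negb_or.
case/and3P => /xy + /xz + /yz; move: x.2 y.2 z.2 => {xy xz yz}.
by move=> [[|[|[|[|[|a]]]]] ?] [[|[|[|[|[|b]]]]] ?] [[|[|[|[|[|c]]]]] ?].
Qed.

(** Two non-adjacent vertices of C_5 have a single common neighbour, so in the
    blow-up the common neighbours of two non-adjacent vertices form a clique. *)
Lemma blown_up_C5_no_C4 : ~~ embeds (C_ 4) blown_up_C5.
Proof.
apply/negP => /embedsP[f [f_inj f_adj]].
pose v k : C_ 4 := inord k.
have far j k : j < 4 -> k < 4 -> j != k -> ~~ cycle_adj (v j) (v k) ->
    ~~ closed_adj (f (v j)).2 (f (v k)).2.
  move=> j4 k4 jk; rewrite -[cycle_adj _ _]f_adj; apply: blown_up_C5_far.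
  by rewrite (inj_eq f_inj) -val_eqE /= !inordK.
have near j k : cycle_adj (v j) (v k) -> closed_adj (f (v j)).2 (f (v k)).2.
  by rewrite -[cycle_adj _ _]f_adj; apply: blown_up_C5_near.
have := far 0 2; have := far 1 3; have := near 0 1; have := near 1 2.
have := near 2 3; have := near 3 0.
rewrite !C4_adjE !inordK //= => /(_ isT) + /(_ isT) + /(_ isT) + /(_ isT).
move=> + + + + /(_ isT isT isT isT) + /(_ isT isT isT isT).
move: (f (v 0)).2 (f (v 1)).2 (f (v 2)).2 (f (v 3)).2 => a b c d.
by case: a b c d => [[|[|[|[|[|a]]]]] ?] [[|[|[|[|[|b]]]]] ?] [[|[|[|[|[|c]]]]] ?]
  [[|[|[|[|[|d]]]]] ?].
Qed.

Lemma matched_cliques_side (x y : matched_cliques) :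
  x != y -> ~~ adj x y -> (x.2 < 2) != (y.2 < 2).
Proof.
case: x y => [i a] [j b]; rewrite /= /layered_adj /half_adj /= xpair_eqE.
case: (i == j) => //=.
by case: a b => [[|[|[|[|a]]]] ?] [[|[|[|[|b]]]] ?].
Qed.

Lemma matched_cliques_indep3_free : indep3_free matched_cliques.
Proof.
move=> x y z xy xz yz; apply/negPn/negP; rewrite !negb_or.
case/and3P=> /(matched_cliques_side xy) + /(matched_cliques_side xz).
move=> + + /(matched_cliques_side yz).
by case: (x.2 < 2) (y.2 < 2) (z.2 < 2) => [] [] [].
Qed.

Lemma matched_cliques_match (x y z : matched_cliques) :
  adj x y -> adj x z ->
  (x.2 < 2) != (y.2 < 2) -> (x.2 < 2) != (z.2 < 2) -> y = z.
Proof.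
case: x y z => [i a] [j b] [k c]; rewrite /= /layered_adj /half_adj /=.
case: eqP => [<-|_ ->] //; case: eqP => [<-|_ _ ->] // ab ac sb sc.
congr (_, _); apply: val_inj; move: ab ac sb sc.
by case: a b c => [[|[|[|[|a]]]] ?] [[|[|[|[|b]]]] ?] [[|[|[|[|c]]]] ?].
Qed.

(** Since x and y are on different sides, each of p and q has one of them on the
    other side, as its match. If p and q are on the same side, both are the match of
    one vertex; otherwise p has q and one of x, y as matches. *)
Lemma matched_cliques_no_diamond (p q x y : matched_cliques) :
  adj p q -> adj p x -> adj p y -> adj q x -> adj q y -> x != y -> adj x y.
Proof.
have sym (u v : matched_cliques) : adj u v -> adj v u by rewrite adj_sym.
have match_in := matched_cliques_match.
move=> pq px py qx qy xy; apply: contraNT xy => nxy.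
have side_xy : x != y -> (x.2 < 2) != (y.2 < 2).
  by move/matched_cliques_side; apply.
apply/negPn/negP => /side_xy {}side_xy.
have not_both (z : matched_cliques) : adj p z -> adj q z ->
    (z.2 < 2) != (p.2 < 2) -> (z.2 < 2) != (q.2 < 2) -> False.
  move=> /sym zp /sym zq p_z q_z; have := match_in _ _ _ zp zq p_z q_z.
  by move=> e; have := adj_neq pq; rewrite e eqxx.
have not_cross (z : matched_cliques) : adj p z -> adj q z ->
    (p.2 < 2) != (z.2 < 2) -> (p.2 < 2) != (q.2 < 2) -> False.
  move=> pz qz z_p q_p; have := match_in _ _ _ pz pq z_p q_p.
  by move=> e; have := adj_neq qz; rewrite e eqxx.
move: (not_both x px qx) (not_both y py qy) (not_cross x px qx).
move: (not_cross y py qy) side_xy.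
by case: (x.2 < 2) (y.2 < 2) (p.2 < 2) (q.2 < 2) => [] [] [] [] //= A _ B C D;
  first [exact: A | exact: B | exact: C | exact: D].
Qed.
End Hosts.

(** * Graphs contained in members of two families *)

(** The two neighbours of a position are its successor and its predecessor. *)
Lemma C6s_nbr_inj n (u x y : disjoint_C6s n) : adj u x -> adj u y ->
  (x.2 == ordS u.2) = (y.2 == ordS u.2) -> x = y.
Proof.
case: u x y => [i a] [j b] [k c] /C6s_adjP[/= <- ab] /C6s_adjP[/= <- ac] e.
congr (_, _); apply: val_inj; move: ab ac e.
by case: a b c => [[|[|[|[|[|[|a]]]]]] ?] [[|[|[|[|[|[|b]]]]]] ?]
  [[|[|[|[|[|[|c]]]]]] ?].
Qed.

(** A triangle-free graph meets at most two of the classes of non-adjacency: the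
    non-neighbours of a vertex u form one, the neighbours of u the other. *)
Lemma cocktail_triangle_free_C4 X n :
  embeds X (cocktail_party n) -> triangle_free X -> embeds X (C_ 4).
Proof.
case/embedsP=> f [f_inj f_adj] /triangle_freeP X_free.
have [u _|X0] := pickP (pred_of_simpl (predT : simpl_pred X)); last first.
  by apply: (@bits_embed_C4 _ xpredT xpredT) => x; have := X0 x.
have nadjE x y : ~~ adj x y =
    ((f x).1 == (f y).1) && (odd (f x).2 == odd (f y).2).
  by rewrite -f_adj cocktail_nonadj.
have X_adj x y : adj x y = (adj u x != adj u y).
  case ux: (adj u x); case uy: (adj u y).
  - exact/negbTE/(X_free u).
  - apply: contraTT ux; move/negbT: uy; rewrite !nadjE.
    by move=> /andP[/eqP-> /eqP->] /andP[/eqP-> /eqP->]; rewrite !eqxx.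
  - apply: contraTT uy; move/negbT: ux; rewrite !nadjE.
    by move=> /andP[/eqP-> /eqP->] /andP[/eqP-> /eqP->]; rewrite !eqxx.
  - move/negbT: ux; move/negbT: uy; rewrite -[RHS]/(~~ true) -[LHS]negbK !nadjE.
    by move=> /andP[/eqP<- /eqP<-] /andP[/eqP<- /eqP<-]; rewrite !eqxx.
apply: (@bits_embed_C4 _ (adj u) (fun x => (f x).2 < 2)) => // x y [s_eq b_eq].
apply: f_inj; have : ~~ adj x y by rewrite X_adj s_eq eqxx.
rewrite nadjE; case: (f x) (f y) b_eq => [i a] [j b] /= ab /andP[/eqP-> ab'].
congr (_, _); apply: val_inj; move: ab ab'.
by case: a b => [[|[|[|[|a]]]] ?] [[|[|[|[|b]]]] ?].
Qed.

Lemma bipartite_triangle_free X n :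
  embeds X (complete_bipartite n) -> triangle_free X.
Proof.
case/embedsP=> f [_ f_adj]; apply/triangle_freeP => x y z.
rewrite -!f_adj !bipartite_adj.
by case: (odd _) (odd _) (odd _) => [] [] [].
Qed.

Lemma C6s_triangle_free X n : embeds X (disjoint_C6s n) -> triangle_free X.
Proof.
case/embedsP=> f [_ f_adj]; apply/triangle_freeP => x y z.
rewrite -!f_adj => /C6s_adjP[_ /C6_adj_parity xy] /C6s_adjP[_ /C6_adj_parity xz].
apply/negP => /C6s_adjP[_ /C6_adj_parity]; move: xy xz.
by case: (odd _) (odd _) (odd _) => [] [] [].
Qed.

(** If uv is an edge, all vertices are adjacent to exactly one of u and v. Degrees in
    a union of hexagons are at most two, which leaves two vertices on each side. *)
Lemma C6s_bipartite X n m :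
  embeds X (disjoint_C6s n) -> embeds X (complete_bipartite m) ->
  edgeless X \/ embeds X (C_ 4).
Proof.
case/embedsP=> f [f_inj f_adj] /embedsP[g [_ g_adj]].
case: (boolP [exists u, exists v, @adj X u v]); last first.
  move=> /existsPn no_edge; left=> u v.
  by have /existsPn := no_edge u.
case/existsP=> u /existsP[v uv]; right.
have adjE x y : adj x y = (odd (g x).2 != odd (g y).2).
  by rewrite -g_adj bipartite_adj.
have other x : ~~ adj u x -> adj v x.
  move: uv; rewrite !adjE.
  by case: (odd _) (odd _) (odd _) => [] [] [].
pose centre x := if adj u x then u else v.
have centreP x : adj (centre x) x by rewrite /centre; case: ifP => // /negbT/other.
apply: (@bits_embed_C4 _ (adj u)
          (fun x => (f x).2 == ordS (f (centre x)).2)) => x y.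
  by rewrite !adjE; case: (odd _) (odd _) (odd _) => [] [] [].
case=> s_eq; have centre_eq : centre x = centre y by rewrite /centre s_eq.
rewrite -centre_eq => b_eq; apply: f_inj; apply: C6s_nbr_inj b_eq.
  by rewrite f_adj.
by rewrite f_adj centre_eq.
Qed.

(** If two layers are met, each is met in a clique, that is, in at most an edge. In a
    single hexagon, alternate vertices are independent, so one vertex is missed and
    the rest is a P_5. *)
Lemma C6s_P4_or_two_K2 X n : embeds X (disjoint_C6s n) -> indep3_free X ->
  embeds X (P_ 4) \/ embeds X two_K2.
Proof.
case/embedsP=> f [f_inj f_adj] X_free.
case: (boolP [exists u, exists v, (f u).1 != (f v).1]); last first.
  move=> /existsPn one_layer.
  have layer_eq x y : (f x).1 = (f y).1.
    by have /existsPn/(_ y) := one_layer x; rewrite negbK => /eqP.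
  have /embeds_iso_or_miss : embeds X (C_ 6).
    apply/embedsP; exists (fun x => (f x).2); split=> x y.
      move=> e; apply: f_inj; move: (layer_eq x y) e.
      by case: (f x) (f y) => [i a] [j b] /= -> ->.
    by rewrite -f_adj /= /layered_adj (layer_eq x y) eqxx.
  case=> [/iso_sym/iso_embeds C_X|[h [v [h_inj h_adj h_miss]]]].
    have := embeds_indep3_free C_X X_free.
    move/(_ (inord 0) (inord 2) (inord 4)).
    by rewrite -!val_eqE /= !cycle_adjE !inordK // => /(_ isT isT isT).
  by apply: indep3_free_path5 => //; apply: miss_cycle_embeds_path h_miss.
case/existsP=> u /existsP[v uv]; right.
(* A vertex of another layer turns two independent vertices into three. *)
have layer_clique x y :
    ((f x).1 == (f u).1) = ((f y).1 == (f u).1) -> x != y -> adj x y.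
  move=> xy_side xy.
  pose w := if (f x).1 == (f u).1 then v else u.
  have away z : ((f z).1 == (f u).1) = ((f x).1 == (f u).1) ->
      (z != w) /\ ~~ adj z w.
    move=> zx; have zw : (f z).1 != (f w).1.
      rewrite /w; case: ifP zx => [_ /eqP->|_ /negbT] //.
    split; first by apply: contra_neq zw => ->.
    by rewrite -f_adj /= /layered_adj (negbTE zw).
  have [xw nxw] := away x erefl; have [yw nyw] := away y (esym xy_side).
  by have := X_free x y w xy xw yw; rewrite (negbTE nxw) (negbTE nyw) !orbF.
apply: (@bits_embed_two_K2 _ (fun x => (f x).1 == (f u).1)
                             (fun x => odd (f x).2)) => x y.
  case: (eqVneq x y) => [->|xy]; first by rewrite adj_irrefl !eqxx.
  case: (eqVneq ((f x).1 == (f u).1) ((f y).1 == (f u).1)) => side /=.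
    have a_xy := layer_clique x y side xy; rewrite a_xy; apply/esym.
    by move: a_xy; rewrite -f_adj => /C6s_adjP[_ /C6_adj_parity].
  by apply/negP; rewrite -f_adj => /C6s_adjP[e]; rewrite e eqxx in side.
case=> side /eqP; apply: contraTeq => /(layer_clique x y side).
by rewrite -f_adj => /C6s_adjP[_ /C6_adj_parity].
Qed.

(** Non-adjacent vertices x and y of a cocktail party graph have the same neighbours,
    and at most one vertex of a triangle is outside this neighbourhood. The other two
    would form a diamond with x and y. *)
Lemma cocktail_matched_cliques X n m :
  embeds X (cocktail_party n) -> embeds X (matched_cliques m) ->
  ~~ triangle_free X -> complete X.
Proof.
case/embedsP=> f [f_inj f_adj] /embedsP[g [g_inj g_adj]].
rewrite negbK => /existsP[t1 /existsP[t2 /existsP[t3 /and3P[t12 t13 t23]]]].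
move=> x y xy; apply: contraT => nxy.
have nadjE u v : ~~ adj u v =
    ((f u).1 == (f v).1) && (odd (f u).2 == odd (f v).2).
  by rewrite -f_adj cocktail_nonadj.
have nadj_trans (w u v : X) : ~~ adj w u -> ~~ adj w v -> ~~ adj u v.
  rewrite !nadjE => /andP[/eqP-> /eqP->] /andP[/eqP-> /eqP->].
  by rewrite !eqxx.
have twin u : adj x u -> adj y u.
  by apply: contraTT; apply: nadj_trans; rewrite adj_sym.
have no_diamond p q : adj p q -> adj x p -> ~~ adj x q.
  move=> pq xp; apply: contraNN nxy => xq; rewrite -g_adj.
  apply: (@matched_cliques_no_diamond m (g p) (g q));
    rewrite ?(inj_eq g_inj) ?g_adj //; by rewrite adj_sym ?twin.
have one_side p q : adj p q -> ~~ adj x p -> adj x q.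
  by move=> pq xp; apply: contraTT pq; apply: nadj_trans.
case x1: (adj x t1).
  by have := one_side _ _ t23 (no_diamond _ _ t12 x1);
     rewrite (negbTE (no_diamond _ _ t13 x1)).
move/negbT: x1 => x1.
by have := no_diamond _ _ t23 (one_side _ _ t12 x1);
   rewrite (one_side _ _ t13 x1).
Qed.

Lemma edgeless_matched_cliques X n :
  edgeless X -> embeds X (matched_cliques n) -> embeds X (P_ 3).
Proof.
move=> X_edgeless /embedsP[f [f_inj f_adj]].
pose pos x : 'I_3 := if (f x).2 < 2 then ord0 else ord_max.
apply/embedsP; exists pos; split=> x y; last first.
  rewrite (negbTE (X_edgeless x y)) /= /path_adj /pos.
  by case: ifP; case: ifP.
move=> pos_eq; apply: f_inj; apply/eqP; apply: contraT.
move/matched_cliques_side; rewrite f_adj => /(_ (X_edgeless x y)).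
by move: pos_eq; rewrite /pos; case: ifP; case: ifP.
Qed.

(** * The five families together *)

Lemma unbounded_hosts A B n :
  (forall r (E : rel 'I_r) (E_sym : symmetric E), 3 < r ->
     exists m, embeds A (layered E_sym m) \/ embeds B (layered E_sym m)) ->
  embeds A (disjoint_C6s n) ->
  [\/ embeds A (P_ 3), embeds B (P_ 3),
      (embeds A (P_ 4) \/ iso A two_K2) /\ iso B (C_ 4)
    | complete B /\ edgeless A].
Proof.
move=> hosts A_C6s.
have A_C4 : embeds A (C_ 4) -> embeds A (P_ 3).
  case/embeds_C4=> // /iso_sym/iso_embeds C_A.
  by have := C6s_no_C4 n; rewrite (embeds_trans C_A A_C6s).
have [m [A_cp|B_cp]] := hosts _ _ (@full_adj_sym 4) isT.
  constructor 1; apply/A_C4/(cocktail_triangle_free_C4 A_cp).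
  exact: C6s_triangle_free A_C6s.
case: (boolP (triangle_free B)) => [B_free|B_tri].
  case: (embeds_C4 (cocktail_triangle_free_C4 B_cp B_free)) => [|B_iso].
    by constructor 2.
  have [k [A_bu|B_bu]] := hosts _ _ (@closed_adj_sym 5) isT.
    have A_free := embeds_indep3_free A_bu (@blown_up_C5_indep3_free k).
    case: (C6s_P4_or_two_K2 A_C6s A_free) => [A_P4|/embeds_two_K2[]];
      by constructor 3; auto.
  have C_B := iso_embeds (iso_sym B_iso).
  by have := blown_up_C5_no_C4 k; rewrite (embeds_trans C_B B_bu).
have [k [A_bip|/bipartite_triangle_free]] := hosts _ _ (@parity_adj_sym 4) isT;
  last by rewrite (negbTE B_tri).
case: (C6s_bipartite A_C6s A_bip) => [A_edgeless|/A_C4]; last by constructor 1.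
have [l [A_mc|B_mc]] := hosts _ _ half_adj_sym isT.
  by constructor 1; apply: edgeless_matched_cliques A_mc.
constructor 4; split=> //; exact: cocktail_matched_cliques B_cp B_mc B_tri.
Qed.


(** * Ramsey's theorem *)

Section Ramsey.
Variable T : finType.
Implicit Types (p : rel T) (S K : {set T}).

Definition has_clique p k S : Prop :=
  exists K, [/\ K \subset S, #|K| = k & {in K &, forall x y, x != y -> p x y}].

Lemma has_clique0 p S : has_clique p 0 S.
Proof.
by exists set0; rewrite sub0set cards0; split=> // x y; rewrite inE.
Qed.

Lemma has_cliqueS p k S S' :
  S \subset S' -> has_clique p k S -> has_clique p k S'.
Proof.
by move=> SS' [K [KS cK pK]]; exists K; split=> //; apply: subset_trans SS'.
Qed.

Lemma has_cliqueU1 p k v S : symmetric p -> v \in S ->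
  has_clique p k [set u in S :\ v | p v u] -> has_clique p k.+1 S.
Proof.
move=> p_sym vS [K [/subsetP K_nbr <- pK]].
have K_v u : u \in K -> [/\ u != v, u \in S & p v u].
  by move=> /K_nbr; rewrite !inE => /andP[/andP[]].
exists (v |: K); split.
- by apply/subsetP => u /setU1P[->|/K_v[]].
- by rewrite cardsU1; case: (boolP (v \in K)) => // /K_v[]; rewrite eqxx.
move=> x y /setU1P[->|xK] /setU1P[->|yK]; rewrite ?eqxx //.
- by case: (K_v y yK).
- by rewrite p_sym; case: (K_v x xK).
exact: pK.
Qed.

(** The other elements of S are split into neighbours and non-neighbours of a chosen
    one; one of the two parts has at least half the size required of S. *)
Lemma ramsey p a b S : symmetric p -> 2 ^ (a + b) <= #|S| ->
  has_clique p a S \/ has_clique [rel x y | ~~ p x y] b S.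
Proof.
move=> p_sym; elim: a b S => [|a IHa] b S; first by left; apply: has_clique0.
elim: b S => [|b IHb] S S_big; first by right; apply: has_clique0.
have /card_gt0P[v vS] : 0 < #|S| by apply: leq_trans S_big; rewrite expn_gt0.
pose N := [set u in S :\ v | p v u].
pose M := [set u in S :\ v | [rel x y | ~~ p x y] v u].
have subS (q : rel T) : [set u in S :\ v | q v u] \subset S.
  by apply/subsetP => u; rewrite !inE => /andP[/andP[]].
have NS : N \subset S := subS p.
have MS : M \subset S := subS [rel x y | ~~ p x y].
have card_S : #|S| = (#|N| + #|M|).+1.
  rewrite (cardsD1 v S) vS -(cardsID [set u | p v u] (S :\ v)); congr (_ + _).+1.
    by apply: eq_card => u; rewrite !inE.
  by apply: eq_card => u; rewrite !inE andbC.
case: (leqP (2 ^ (a + b.+1)) #|N|) => [/IHa[aN|bN]|N_small].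
- by left; apply: has_cliqueU1 aN.
- by right; apply: has_cliqueS bN; exact: NS.
have /IHb[aM|bM] : 2 ^ (a.+1 + b) <= #|M|.
  move: S_big N_small; rewrite card_S !addSn !addnS !expnS; lia.
- by left; apply: has_cliqueS aM; exact: MS.
- right; apply: has_cliqueU1 bM => // x y /=; by rewrite p_sym.
Qed.

End Ramsey.

Lemma homogeneous_embeds (X G : sgraph) (K : {set G}) (c : bool) :
  #|K| = #|X| -> (forall x y : X, x != y -> adj x y = c) ->
  {in K &, forall x y, x != y -> adj x y = c} -> embeds X G.
Proof.
move=> card_K X_adj K_adj.
pose f (x : X) : G := enum_val (cast_ord (esym card_K) (enum_rank x)).
have f_inj : injective f.
  by move=> x y /enum_val_inj/cast_ord_inj/enum_rank_inj.
apply/embedsP; exists f; split=> // x y.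
case: (eqVneq x y) => [->|xy]; first by rewrite !adj_irrefl.
by rewrite (X_adj _ _ xy) K_adj ?enum_valP // (inj_eq f_inj).
Qed.

Lemma complete_edgeless_bound A B G : complete A -> edgeless B ->
  ~~ embeds A G -> ~~ embeds B G -> #|G| <= 2 ^ (#|A| + #|B|).
Proof.
move=> A_complete B_edgeless nA nB; rewrite leqNgt -(cardsT G).
apply/negP => /ltnW big.
case: (ramsey (@adj_sym G) big) => -[K [_ card_K K_adj]].
  case/negP: nA; apply: (homogeneous_embeds (c := true) card_K).
    exact: A_complete.
  exact: K_adj.
case/negP: nB; apply: (homogeneous_embeds (c := false) card_K).
  by move=> x y _; apply/negbTE/B_edgeless.
by move=> x y xK yK xy; apply/negbTE/K_adj.
Qed.

(** * Chordality from excluded subgraphs *)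

Lemma chordal_embeds H G : embeds H G -> chordal G -> chordal H.
Proof.
move=> H_G G_chordal r r_ge4 /induced_subgraphP C_H.
by apply: (G_chordal r r_ge4); apply/induced_subgraphP/(embeds_trans C_H).
Qed.

Lemma chordal_apex c (CC : graph_class) :
  (forall G, CC G -> chordal G) -> apex_chordal c CC.
Proof.
move=> CC_chordal G /CC_chordal G_chordal; exists set0; rewrite cards0; split=> //.
exact: chordal_embeds (induced_embeds _) G_chordal.
Qed.

Lemma path3_free_chordal A G :
  embeds A (P_ 3) -> ~~ embeds A G -> chordal G.
Proof.
move=> A_P nA r r_ge4 /induced_subgraphP C_G.
by have := hole_length nA A_P C_G; rewrite leqNgt r_ge4.
Qed.

Lemma path4_C4_free_chordal A B G : embeds A (P_ 4) -> iso B (C_ 4) ->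
  ~~ embeds A G -> ~~ embeds B G -> chordal G.
Proof.
move=> A_P B_C nA nB r r_ge4 /induced_subgraphP C_G.
have r4 : r = 4 by apply/eqP; rewrite eqn_leq r_ge4 (hole_length nA A_P C_G).
rewrite r4 in C_G.
by case/negP: nB; apply: embeds_trans (iso_embeds B_C) C_G.
Qed.

(** 2K_2 is P_5 without its centre. *)
Lemma two_K2_embeds_path5 : embeds two_K2 (P_ 5).
Proof.
pose pos (w : two_K2) : nat := match w with inl i => i | inr i => 3 + i end.
have pos_lt w : pos w < 5.
  by case: w => i /=; have := ltn_ord i; lia.
apply/embedsP; exists (fun w => Ordinal (pos_lt w)); split.
  move=> v w /(congr1 val) /=.
  case: v w => [i|i] [j|j] /= e; have := ltn_ord i; have := ltn_ord j => jlt ilt;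
    first [by congr (_ _); apply: val_inj => /=; lia | lia].
by move=> [[[|[|i]] ?]|[[|[|i]] ?]] // [[[|[|j]] ?]|[[|[|j]] ?]].
Qed.

(** * Graphs without induced C_4 and 2K_2 *)

Section PseudoSplit.
Variable G : sgraph.
Hypothesis no_C4 : ~~ embeds (C_ 4) G.
Hypothesis no_two_K2 : ~~ embeds two_K2 G.

Lemma square_has_diagonal (a b c d : G) :
  adj a b -> adj b c -> adj c d -> adj d a -> a != c -> b != d ->
  adj a c || adj b d.
Proof.
move=> ab bc cd da ac bd; apply: contraNT no_C4.
rewrite negb_or => /andP[nac nbd].
pose f (i : 'I_4) := nth a [:: a; b; c; d] i.
have f_adj : {mono f : i j / cycle_adj i j >-> adj i j}.
  move=> i j; rewrite C4_adjE /f.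
  case: i j => [[|[|[|[|i]]]] ?] [[|[|[|[|j]]]] ?] //=;
    rewrite ?adj_irrefl ?ab ?bc ?cd ?da //;
    try exact: negbTE; by rewrite adj_sym ?ab ?bc ?cd ?da //; apply: negbTE.
apply/embedsP; exists f; split=> // i j fij.
have f_uniq : uniq [:: a; b; c; d].
  rewrite /= !inE !negb_or ac bd !adj_neq //; by rewrite adj_sym.
by apply/val_inj/eqP; rewrite -(nth_uniq a _ _ f_uniq) ?ltn_ord //; apply/eqP.
Qed.

Lemma edges_are_joined (a b c d : G) : adj a b -> adj c d ->
  [|| adj a c, adj a d, adj b c | adj b d].
Proof.
move=> ab cd; apply: contraNT no_two_K2; rewrite !negb_or.
case/and4P => ac ad bc bd.
pose f (w : two_K2) : G := match w with
  | inl i => if i == ord0 then a else b | inr i => if i == ord0 then c else d end.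
apply/embedsP; exists f.
have f_adj : {mono f : v w / adj v w}.
  case=> [[[|[|i]] ?]|[[|[|i]] ?]] // [[[|[|j]] ?]|[[|[|j]] ?]] //=;
    rewrite /f /= ?adj_irrefl ?ab ?cd //;
    first [exact: negbTE | by rewrite adj_sym ?ab ?cd //; apply: negbTE].
(* A vertex of 2K_2 is determined by its neighbour, so preserving adjacency is
   enough for injectivity. *)
split=> // v w f_vw; pose mate (x : two_K2) : two_K2 :=
  match x with inl i => inl (rev_ord i) | inr i => inr (rev_ord i) end.
have v_mate : adj v (mate v) by case: v {f_vw} => [[[|[|i]] ?]|[[|[|i]] ?]].
move: (v_mate); rewrite -f_adj f_vw f_adj {f_vw}; move: v_mate.
case: v w => [[[|[|i]] ?]|[[|[|i]] ?]] // [[[|[|j]] ?]|[[|[|j]] ?]] //= _ _;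
  by congr (_ _); apply: val_inj.
Qed.

Section PentagonNeighbours.
Variable f : C_ 5 -> G.
Hypothesis f_inj : injective f.
Hypothesis f_adj : {mono f : i j / adj i j}.

(** By the absence of C_4, the neighbourhood of v on the pentagon contains the
    vertex between any two of its members at distance two. By the absence of 2K_2, a
    neighbour k of v comes with one of the ends of the edge opposite to k. A nonempty
    set with both properties is the whole pentagon. *)
Lemma pentagon_homogeneous (v : G) (i j : C_ 5) :
  (forall k, f k != v) -> adj v (f i) = adj v (f j).
Proof.
move=> f_miss.
pose nbr k := adj v (f k).
have gap k l m : cycle_adj k l -> cycle_adj l m -> ~~ cycle_adj k m -> k != m ->
    nbr k && nbr m ==> nbr l.
  move=> kl lm km k_m; apply/implyP => /andP[vk vm].
  have := @square_has_diagonal v (f k) (f l) (f m).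
  rewrite [adj (f m) v]adj_sym [v == _]eq_sym f_miss (inj_eq f_inj) !f_adj.
  by rewrite [@adj (C_ 5) k m](negbTE km) orbF; apply.
have opp k l m : cycle_adj l m -> ~~ cycle_adj k l -> ~~ cycle_adj k m ->
    nbr k ==> nbr l || nbr m.
  move=> lm kl km; apply/implyP => vk.
  have := @edges_are_joined v (f k) (f l) (f m) vk.
  rewrite !f_adj [@adj (C_ 5) k l](negbTE kl) [@adj (C_ 5) k m](negbTE km).
  by rewrite !orbF; apply.
rewrite -/(nbr i) -/(nbr j).
pose o k (k_lt : k < 5) : 'I_5 := Ordinal k_lt.
pose o0 := @o 0 isT; pose o1 := @o 1 isT; pose o2 := @o 2 isT.
pose o3 := @o 3 isT; pose o4 := @o 4 isT.
have nbr0 k : nbr k = nbr o0.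
  move: (gap o0 o1 o2 isT isT isT isT) (gap o1 o2 o3 isT isT isT isT)
        (gap o2 o3 o4 isT isT isT isT) (gap o3 o4 o0 isT isT isT isT)
        (gap o4 o0 o1 isT isT isT isT)
        (opp o0 o2 o3 isT isT isT) (opp o1 o3 o4 isT isT isT)
        (opp o2 o4 o0 isT isT isT) (opp o3 o0 o1 isT isT isT)
        (opp o4 o1 o2 isT isT isT).
  have -> : nbr k = nth false [:: nbr o0; nbr o1; nbr o2; nbr o3; nbr o4] k.
    case: k => [[|[|[|[|[|k]]]]] k_lt] //=;
      by rewrite (bool_irrelevance k_lt isT).
  by case: k => [[|[|[|[|[|k]]]]] k_lt] //=;
    case: (nbr o0) (nbr o1) (nbr o2) (nbr o3) (nbr o4) => [] [] [] [] [].
by rewrite !nbr0.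
Qed.

(** Off the pentagon, the vertices complete to it form a clique and the others an
    independent set. A second pentagon has at most two vertices in each of them, and
    longer holes contain 2K_2. *)
Lemma delete_pentagon_chordal : chordal (delete [set f k | k : C_ 5]).
Proof.
move=> r r_ge4 /induced_subgraphP C_D.
have C_G := embeds_trans C_D (induced_embeds _).
have r_le5 : r <= 5 := hole_length no_two_K2 two_K2_embeds_path5 C_G.
have r_5 : r = 5.
  by apply/eqP; rewrite eqn_leq r_le5 ltn_neqAle r_ge4 andbT;
     apply: contraNneq no_C4 => ->.
subst r; case/embedsP: C_D => h [h_inj h_adj].
pose g k : G := val (h k).
have g_inj : injective g by move=> k l /val_inj/h_inj.
have g_adj : {mono g : k l / adj k l} by move=> k l; rewrite -h_adj.
have off (k l : C_ 5) : f l != g k.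
  have := valP (h k); rewrite inE -/(g k); apply: contraNneq => <-.
  exact: imset_f.
pose full k := adj (g k) (f ord0).
have fullE k l : adj (g k) (f l) = full k by apply: pentagon_homogeneous.
have clique k l : k != l -> ~~ cycle_adj k l -> ~~ (full k && full l).
  move=> kl nkl; apply/negP => /andP[k_full l_full].
  have := @square_has_diagonal (g k) (f (inord 0)) (g l) (f (inord 2)).
  rewrite !fullE ![adj (f _) (g _)]adj_sym !fullE k_full l_full !(inj_eq g_inj) kl.
  rewrite (inj_eq f_inj) g_adj f_adj /= (negbTE nkl) cycle_adjE -val_eqE /=.
  rewrite !inordK //.
  by move/(_ isT isT isT isT isT isT).
have indep k l : cycle_adj k l -> full k || full l.
  move=> kl; have := @edges_are_joined (g k) (g l) (f (inord 0)) (f (inord 1)).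
  rewrite !fullE g_adj f_adj [@adj (C_ 5) k l]kl /= cycle_adjE !inordK //=.
  by move/(_ isT isT); rewrite orbA orbb orbb.
pose o k (k_lt : k < 5) : 'I_5 := Ordinal k_lt.
pose o0 := @o 0 isT; pose o1 := @o 1 isT; pose o2 := @o 2 isT.
pose o3 := @o 3 isT; pose o4 := @o 4 isT.
move: (clique o0 o2 isT isT) (clique o1 o3 isT isT) (clique o2 o4 isT isT)
      (clique o3 o0 isT isT) (clique o4 o1 isT isT)
      (indep o0 o1 isT) (indep o1 o2 isT) (indep o2 o3 isT) (indep o3 o4 isT)
      (indep o4 o0 isT).
by case: (full o0) (full o1) (full o2) (full o3) (full o4) => [] [] [] [] [].
Qed.
End PentagonNeighbours.
End PseudoSplit.

(** * The classification *)

Lemma bounded_two_K2_C4 A B : iso A two_K2 -> iso B (C_ 4) ->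
  apex_chordal 5 (free (pair_set A B)).
Proof.
move=> A_iso B_iso G /free_pairP[nA nB].
have no_C4 : ~~ embeds (C_ 4) G.
  by apply: contraNN nB; apply: embeds_trans; apply: iso_embeds.
have no_two_K2 : ~~ embeds two_K2 G.
  by apply: contraNN nA; apply: embeds_trans; apply: iso_embeds.
case: (boolP (embeds (C_ 5) G)) => [/embedsP[f [f_inj f_adj]]|no_C5].
  exists [set f k | k : C_ 5]; split; last exact: delete_pentagon_chordal.
  by rewrite card_imset // card_ord.
exists set0; rewrite cards0; split=> //.
apply: chordal_embeds (induced_embeds _) _.
move=> r r_ge4 /induced_subgraphP C_G.
have := hole_length no_two_K2 two_K2_embeds_path5 C_G.
rewrite leq_eqVlt => /orP[/eqP r5|r_lt5]; first by rewrite -r5 C_G in no_C5.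
have r4 : r = 4 by apply/eqP; rewrite eqn_leq -ltnS r_lt5.
by rewrite -r4 C_G in no_C4.
Qed.

Lemma bounded_complete_edgeless A B : complete A -> edgeless B ->
  apex_chordal (2 ^ (#|A| + #|B|)) (free (pair_set A B)).
Proof.
move=> A_complete B_edgeless G /free_pairP[nA nB]; exists setT; split.
  by rewrite cardsT; apply: complete_edgeless_bound.
move=> [|r] // _ /induced_subgraphP/embedsP[f _].
by have := valP (f ord0); rewrite !inE.
Qed.

Definition bounding A B : Prop :=
  induced_subgraph A (P_ 3) \/
  (induced_subgraph A (P_ 4) /\ iso B (C_ 4)) \/
  (iso A two_K2 /\ iso B (C_ 4)) \/
  (complete A /\ edgeless B).

Lemma bounding_bounded A B :
  bounding A B -> bounded_apex_chordal (free (pair_set A B)).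
Proof.
case=> [/induced_subgraphP A_P3|[[/induced_subgraphP A_P4 B_C4]|[]]].
- exists 0; apply: chordal_apex => G /free_pairP[nA _].
  exact: path3_free_chordal A_P3 nA.
- exists 0; apply: chordal_apex => G /free_pairP[nA nB].
  exact: path4_C4_free_chordal A_P4 B_C4 nA nB.
- by case=> A_iso B_iso; exists 5; apply: bounded_two_K2_C4.
by case=> A_complete B_edgeless; eexists; apply: bounded_complete_edgeless.
Qed.

Lemma bounded_bounding A B : bounded_apex_chordal (free (pair_set A B)) ->
  bounding A B \/ bounding B A.
Proof.
move=> AB_bounded.
have hosts r E (E_sym : symmetric E) :=
  @bounded_embeds_layered A B r E E_sym AB_bounded.
have C6_case X Y n :
    (forall r (E : rel 'I_r) (E_sym : symmetric E), 3 < r ->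
       exists m, embeds X (layered E_sym m) \/ embeds Y (layered E_sym m)) ->
    embeds X (disjoint_C6s n) -> bounding X Y \/ bounding Y X.
  move=> XY_hosts /(unbounded_hosts XY_hosts)[XP|YP|[XP Y_C4]|[Y_comp X_edgl]].
  - by left; left; apply/induced_subgraphP.
  - by right; left; apply/induced_subgraphP.
  - left; case: XP => [XP|X_iso]; right; last by right; left.
    by left; split=> //; apply/induced_subgraphP.
  by right; right; right; right.
have [n [A_C6s|B_C6s]] := hosts 6 _ (@no_adj_sym 6) isT.
  exact: C6_case hosts A_C6s.
apply/or_comm/(C6_case _ _ n) => // r E E_sym r_gt3.
by have [m /or_comm] := hosts r E E_sym r_gt3; exists m.
Qed.

Theorem theorem6p4 (H1 H2 : sgraph) :
  (bounded_apex_chordal (free (pair_set H1 H2)) <->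
   exists A B : sgraph,
     ((A = H1 /\ B = H2) \/ (A = H2 /\ B = H1)) /\
     (induced_subgraph A (P_ 3) \/
      (induced_subgraph A (P_ 4) /\ iso B (C_ 4)) \/
      (iso A two_K2 /\ iso B (C_ 4)) \/
      (complete A /\ edgeless B)))
  /\
  ((induced_subgraph H1 (P_ 4) /\ iso H2 (C_ 4)) \/
   (induced_subgraph H2 (P_ 4) /\ iso H1 (C_ 4)) ->
   apex_chordal 0 (free (pair_set H1 H2)) /\
   forall G : sgraph, free (pair_set H1 H2) G -> chordal G).
Proof.
split; first split.
- case/bounded_bounding=> H12; first by exists H1, H2; split; [left|].
  by exists H2, H1; split; [right|].
- case=> A [B [AB /bounding_bounded[c c_apex]]]; exists c.
  case: AB c_apex => -[-> ->] // c_apex G /free_pairC; exact: c_apex.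
move=> H12.
have H12_chordal G : free (pair_set H1 H2) G -> chordal G.
  case/free_pairP=> nH1 nH2.
  by case: H12 => -[/induced_subgraphP H_P4 H_C4];
    apply: path4_C4_free_chordal H_P4 H_C4 _ _.
by split=> //; apply: chordal_apex.
Qed.
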